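(* Let $X\subset[0,1]$. Then $$\overline{\dim}_{GB}(X)=\limsup_{m\to\infty}\frac{\log g_m(X)}{\log m},$$ where $g_m(X)=\sum_{k=1}^{m}\min\Big\{m,\ \#\big(X\cap[\tfrac{k-1}{m},\tfrac{k}{m}]\big)\Big\}$.
   Context: For $\delta>0$ and $F\subset\mathbb{R}^d$, $N_\delta(F)$ denotes the number of cubes of the standard $\delta$-grid $\{\prod_{i=1}^d[n_i\delta,(n_i+1)\delta]: n_i\in\mathbb{Z}\}$ that intersect $F$, and the upper box dimension is $\overline{\dim}_B(F)=\limsup_{\delta\to0}\frac{\log N_\delta(F)}{-\log\delta}$. $C_u(X)$ denotes the set of uniformly continuous real functions on $X$, and for $f\in C_u(X)$, $\mathrm{graph}(f)=\{(x,f(x)):x\in X\}$. The upper graph box dimension of $X$ is $\overline{\dim}_{GB}(X)=\sup_{f\in C_u(X)}\overline{\dim}_B(\mathrm{graph}(f))$. $\#A$ denotes the cardinality of $A$ (possibly infinite; $\min\{m,\infty\}=m$). *)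

(* Defs.v *)
From HB Require Import structures.
From mathcomp Require Import all_boot all_order all_algebra.
From mathcomp Require Import all_classical all_reals all_analysis.
From mathcomp Require Import finmap.

Set Implicit Arguments. Unset Strict Implicit. Unset Printing Implicit Defensive.
Import Order.TTheory GRing.Theory Num.Theory.
Import numFieldTopology.Exports.
Local Open Scope classical_set_scope.
Local Open Scope ring_scope.
Local Open Scope fset_scope.

Section defs.
Variable R : realType.

Definition grid_cubes (d : R) (F : set (R * R)) : set (int * int) :=
  [set n | exists p, F p /\
     (n.1%:~R * d <= p.1 <= (n.1 + 1)%:~R * d) /\
     (n.2%:~R * d <= p.2 <= (n.2 + 1)%:~R * d)].

Definition box_ratio (F : set (R * R)) (d : R) : \bar R :=
  if `[< finite_set (grid_cubes d F) >] then
    ((ln (#|` fset_set (grid_cubes d F) |)%:R) / (- ln d))%:E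
  else +oo%E.

Definition upper_box_dim (F : set (R * R)) : \bar R :=
  limf_esup (box_ratio F) ((0:R)^'+).

Definition unif_cont_on (X : set R) (f : R -> R) : Prop :=
  forall e : R, 0 < e -> exists2 d : R, 0 < d &
    forall x y, X x -> X y -> `|x - y| < d -> `|f x - f y| < e.

Definition graph_of (X : set R) (f : R -> R) : set (R * R) :=
  [set p | X p.1 /\ p.2 = f p.1].

Definition upper_graph_box_dim (X : set R) : \bar R :=
  ereal_sup [set upper_box_dim (graph_of X f) | f in unif_cont_on X].

Definition has_at_least (A : set R) (j : nat) : Prop :=
  exists s : seq R, [/\ uniq s, size s = j & forall x, x \in s -> A x].

(* min {m, #A}  (with min{m, oo} = m) *)
Definition min_card (m : nat) (A : set R) : nat :=
  \max_(j < m.+1 | `[< has_at_least A j >]) j.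

Definition g_m (X : set R) (m : nat) : nat :=
  \sum_(1 <= k < m.+1)
     min_card m (X `&` `[(k.-1)%:R / m%:R, k%:R / m%:R]).

End defs.

(* Main.v *)
Require Import Defs.
From HB Require Import structures.
From mathcomp Require Import all_boot all_order all_algebra.
From mathcomp Require Import all_classical all_reals all_analysis.
From mathcomp Require Import finmap zify lra.
Import Order.TTheory GRing.Theory Num.Theory.
Local Open Scope classical_set_scope.
Local Open Scope ring_scope.

(** Upper bound: over an interval of length [1/m ~ d], a uniformly continuous
    [f] oscillates by less than [1] once [d] is small, so its graph there meets
    at most a constant times [m] cubes, and also at most a constant times
    the number of points of [X] there. Hence [N_d <= 16 g_m].

    Lower bound: fix [r < r1 < limsup] and build nested uniform balls with
    Lipschitz centres [h_i]. Given [h_i], with Lipschitz constant [K], and the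
    radius [a_i], pick a large [m] with [g_m > m ^ r1] and, in each column of
    width [1/m], a fixed proportion (depending on [K] and [a_i]) of the
    [min {m, #}] points of [X]. A Lipschitz perturbation of size at most
    [a_i / 2] spreads the values at the points of a column more than
    [(3 + K) / m] apart, so every function within [1/m] of the new centre has
    a graph meeting at least [c g_m >= m ^ r] cubes of side [1/m]. The common
    point of the balls is uniformly continuous, with a graph of upper box
    dimension at least [r]. *)

(** * Eventual and frequent inequalities from an upper limit along a filter *)

Section LimfEsup.
Context {T : choiceType} {U : filteredType T} {R : realType}.
Implicit Types (f : U -> \bar R) (F : set (set U)) (t : \bar R).

Lemma limf_esup_lt f F t : (limf_esup f F < t)%E ->
  exists2 V, F V & forall x, V x -> (f x < t)%E.
Proof.
rewrite limf_esupE => /ereal_inf_lt [_ [V FV <-]] supt.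
exists V => // x Vx; apply: le_lt_trans supt.
by apply: ereal_sup_ubound; exists x.
Qed.

Lemma limf_esup_le f F t : F [set x | (f x <= t)%E] -> (limf_esup f F <= t)%E.
Proof.
move=> ft; rewrite limf_esupE.
apply: (@le_trans _ _ (ereal_sup (f @` [set x | (f x <= t)%E]))).
  by apply: ereal_inf_lbound; exists [set x | (f x <= t)%E].
by apply: ge_ereal_sup => _ [x ? <-].
Qed.

Lemma limf_esup_ge f F t : (forall V, F V -> exists2 x, V x & (t <= f x)%E) ->
  (t <= limf_esup f F)%E.
Proof.
move=> ft; rewrite limf_esupE; apply: le_ereal_inf_tmp => _ [V FV <-].
have [x Vx tfx] := ft V FV; apply: le_trans tfx _.
by apply: ereal_sup_ubound; exists x.
Qed.

Lemma limf_esup_gt f F t V : (t < limf_esup f F)%E -> F V ->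
  exists2 x, V x & (t < f x)%E.
Proof.
move=> tf FV; have : (t < ereal_sup [set f x | x in V])%E.
  apply: lt_le_trans tf _; rewrite limf_esupE.
  by apply: ereal_inf_lbound; exists V.
by case/ereal_sup_gt => _ [x Vx <-] tfx; exists x.
Qed.

End LimfEsup.

(** * Truncated cardinality of sets of reals *)

Section MinCard.
Context {R : realType}.
Implicit Types (A B : set R) (m j : nat).

Lemma has_at_least_leq A i j : (i <= j)%N -> has_at_least A j ->
  has_at_least A i.
Proof.
move=> ij [s [us ss sA]]; exists (take i s); split.
- exact: take_uniq.
- by rewrite size_takel // ss.
- by move=> x /mem_take; exact: sA.
Qed.

Lemma min_card_le m A : (min_card m A <= m)%N.
Proof. by apply/bigmax_leqP => j _; rewrite -ltnS. Qed.

(** The empty list makes [j = 0] admissible, so the maximum is attained. *)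
Lemma has_at_least_min_card m A : has_at_least A (min_card m A).
Proof.
rewrite /min_card.
have h0 : `[< has_at_least A (ord0 : 'I_m.+1) >] by apply/asboolP; exists [::].
by rewrite (bigop.bigmax_eq_arg ord0) //; case: arg_maxnP => // i /asboolP.
Qed.

Lemma leq_min_card m A j : (j <= m)%N -> has_at_least A j ->
  (j <= min_card m A)%N.
Proof.
move=> jm Aj; have jm1 : (j < m.+1)%N by [].
by apply: (@leq_bigmax_cond _ _ _ (Ordinal jm1)); exact/asboolP.
Qed.

Lemma min_card_sub m A B : A `<=` B -> (min_card m A <= min_card m B)%N.
Proof.
move=> AB; apply: leq_min_card; first exact: min_card_le.
have [s [us ss sA]] := has_at_least_min_card m A.
by exists s; split=> // x /sA /AB.
Qed.

Lemma min_cardU m A B :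
  (min_card m (A `|` B) <= min_card m A + min_card m B)%N.
Proof.
have [s [us ss sAB]] := has_at_least_min_card m (A `|` B).
have sm : (size s <= m)%N by rewrite ss min_card_le.
pose a := [pred x | `[< A x >]].
rewrite -ss -(count_predC a s) -!size_filter; apply: leq_add.
  apply: leq_min_card.
    by rewrite size_filter; apply: leq_trans (count_size _ _) sm.
  exists (seq.filter a s); split=> //; first exact: filter_uniq.
  by move=> x; rewrite mem_filter => /andP[/asboolP].
apply: leq_min_card.
  by rewrite size_filter; apply: leq_trans (count_size _ _) sm.
exists (seq.filter (predC a) s); split=> //; first exact: filter_uniq.
by move=> x; rewrite mem_filter => /andP[/= /asboolP nA /sAB []].
Qed.

(** Below the cap [m], a point of [A] missing from a longest list could be added to it, against
    maximality. *)
Lemma min_card_lt_enum m A : (min_card m A < m)%N ->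
  exists2 s : seq R, size s = min_card m A & forall x, A x -> x \in s.
Proof.
move=> lt_m; have [s [us ss sA]] := has_at_least_min_card m A.
exists s => // x Ax; apply/negPn/negP => xs.
have : ((min_card m A).+1 <= min_card m A)%N.
  apply: leq_min_card => //; exists (x :: s); split => /=.
  - by rewrite xs.
  - by rewrite ss.
  - by move=> y; rewrite inE => /predU1P[->|/sA].
by rewrite ltnn.
Qed.

End MinCard.

(** * Counting grid cubes that meet a graph *)

Section Grid.
Context {R : realType}.
Implicit Types (F : set (R * R)) (X : set R) (d : R) (p : R * R).

Lemma card_grid_cubes_le d F (s : seq (int * int)) :
  (forall n, grid_cubes d F n -> n \in s) ->
  finite_set (grid_cubes d F) /\
  (#|` fset_set (grid_cubes d F)| <= size s)%N.
Proof.
move=> Fs.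
have fin : finite_set (grid_cubes d F).
  by apply: (@sub_finite_set _ _ [set` s]) => //; exact: finite_seq.
split=> //; apply: uniq_leq_size; first exact: fset_uniq.
by move=> n; rewrite in_fset_set // => /set_mem /Fs.
Qed.

Lemma card_grid_cubes_ge d F (s : seq (int * int)) : uniq s ->
  (forall n, n \in s -> grid_cubes d F n) ->
  finite_set (grid_cubes d F) ->
  (size s <= #|` fset_set (grid_cubes d F)|)%N.
Proof.
move=> us sF fin; apply: uniq_leq_size => // n ns.
by rewrite in_fset_set //; apply: mem_set; exact: sF.
Qed.

Definition in_cube d (n : int * int) p : Prop :=
  (n.1%:~R * d <= p.1 <= (n.1 + 1)%:~R * d) /\
  (n.2%:~R * d <= p.2 <= (n.2 + 1)%:~R * d).

Definition int_range (a : int) (l : nat) : seq int :=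
  [seq a + i%:Z | i <- iota 0 l].

Lemma mem_int_range (a : int) (l : nat) (n : int) :
  a <= n < a + l%:Z -> n \in int_range a l.
Proof.
move=> h; apply/mapP; exists `|n - a|%N; last by lia.
by rewrite mem_iota; lia.
Qed.

(** Cubes are closed, so a point on a face also lies in the neighbouring cube; hence the start one
    below the floor and the slack in [l + 3]. *)
Lemma cube_index_range d (u v t : R) (n : int) (l : nat) : 0 < d ->
  u <= t <= v -> v - u <= l%:R * d -> n%:~R * d <= t <= (n + 1)%:~R * d ->
  n \in int_range (Num.floor (u / d) - 1) (l + 3).
Proof.
move=> d0 /andP[ut tv] vu /andP[nt tn]; apply: mem_int_range.
have /andP[fl fu] := floor_itv (u / d).
have un : u / d <= (n + 1)%:~R by rewrite ler_pdivrMr //; lra.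
have nv : n%:~R <= u / d + l%:R.
  rewrite -(ler_pM2r d0) mulrDl divfK ?gt_eqF //; lra.
have h1 : Num.floor (u / d) <= n + 1.
  by rewrite -(ler_int R); apply: le_trans fl un.
have h2 : n < Num.floor (u / d) + 1 + l%:Z.
  rewrite -(ltr_int R) intrD; apply: le_lt_trans nv _.
  by rewrite ltrD2r.
by apply/andP; split; lia.
Qed.

Definition cube_range d (u u' : R) (l l' : nat) : seq (int * int) :=
  [seq (i, j) | i <- int_range (Num.floor (u / d) - 1) (l + 3),
                j <- int_range (Num.floor (u' / d) - 1) (l' + 3)].

Lemma size_cube_range d u u' l l' :
  size (cube_range d u u' l l') = ((l + 3) * (l' + 3))%N.
Proof. by rewrite size_allpairs !size_map !size_iota. Qed.

Lemma mem_cube_range d u v u' v' l l' n p : 0 < d ->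
  u <= p.1 <= v -> v - u <= l%:R * d ->
  u' <= p.2 <= v' -> v' - u' <= l'%:R * d ->
  in_cube d n p -> n \in cube_range d u u' l l'.
Proof.
case: n => i j d0 h1 h2 h3 h4 [/= hi hj]; apply: allpairs_f.
  exact: cube_index_range h1 h2 hi.
exact: cube_index_range h3 h4 hj.
Qed.

Lemma column_cover X (f : R -> R) d (m : nat) (u : R) : 0 < d -> (0 < m)%N ->
  m%:R^-1 <= d -> d^-1 <= m%:R ->
  (forall x y, X x -> X y -> `|x - y| <= m%:R^-1 -> `|f x - f y| < 2^-1) ->
  exists2 s : seq (int * int),
    (size s <= 16 * min_card m (X `&` `[u, (u + m%:R^-1)%R]))%N &
    forall n x, X x -> u <= x <= u + m%:R^-1 -> in_cube d n (x, f x) -> n \in s.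
Proof.
move=> d0 m0 md dm fX; set A := X `&` _.
have := min_card_le m A; rewrite leq_eqVlt => /orP[/eqP cm|/min_card_lt_enum].
  have [s [_ ss sA]] := has_at_least_min_card m A.
  case: s ss sA => [|x0 s] /=; first by rewrite cm => h; rewrite -h in m0.
  move=> _ /(_ x0); rewrite inE eqxx => /(_ isT) [Xx0 /=]; rewrite in_itv /= => ux0.
  (* Saturated column: the graph lies in one box of width [1/m <= d] and height [1 <= m d], covered
     by [4 (m + 3) <= 16 m] cubes. *)
  exists (cube_range d u (f x0 - 2^-1) 1 m).
    by rewrite size_cube_range cm; lia.
  move=> n x Xx ux; apply: (@mem_cube_range _ _ (u + m%:R^-1) _ (f x0 + 2^-1)) => //=.
  - by rewrite mul1r; lra.
  - have : `|f x - f x0| < 2^-1.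
      by apply: fX => //; rewrite ler_norml; lra.
    by rewrite ltr_norml; lra.
  - have -> : f x0 + 2^-1 - (f x0 - 2^-1) = 1 :> R by lra.
    by rewrite -ler_pdivrMr // mul1r.
move=> [s ss As].
(* Otherwise [X] has finitely many points in the column, all listed in [s], and at most 9 cubes are
   allotted to each. *)
exists (flatten [seq cube_range d x (f x) 0 0 | x <- s]).
  rewrite -ss size_flatten /shape -map_comp.
  rewrite (@eq_map _ _ _ (fun=> 9%N)); last by move=> x; exact: size_cube_range.
  by rewrite sumnE big_map big_const_seq count_predT iter_addn_0; lia.
move=> n x Xx ux nx; apply/flatten_mapP; exists x.
  by apply: As; split=> //=; rewrite in_itv.
by apply: (@mem_cube_range _ _ x _ (f x)) nx; rewrite //= ?lexx ?subrr ?mul0r.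
Qed.

Lemma grid_column (m : nat) (x : R) : (0 < m)%N -> 0 <= x <= 1 ->
  exists2 k, (0 < k <= m)%N & k.-1%:R / m%:R <= x <= k.-1%:R / m%:R + m%:R^-1.
Proof.
move=> m0 /andP[x0 x1]; have mR : 0 < m%:R :> R by rewrite ltr0n.
have mx0 : 0 <= x * m%:R by rewrite mulr_ge0 // ltW.
have [xlt|xge] := ltP x 1.
  have /andP[tl tu] := truncn_itv mx0.
  exists (Num.trunc (x * m%:R)).+1 => /=.
    rewrite -(ltr_nat R); apply: le_lt_trans tl _.
    by rewrite gtr_pMl.
  rewrite ler_pdivrMr // tl /= -[X in _ + X]mul1r -mulrDl natr1.
  by rewrite ler_pdivlMr // ltW.
(* The point [x = 1] is put in the last column, since truncation would give index [m + 1]. *)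
exists m; first by rewrite m0 leqnn.
have -> : m.-1%:R / m%:R + m%:R^-1 = 1 :> R.
  by rewrite -[X in _ + X]mul1r -mulrDl natr1 prednK // divff // gt_eqF.
rewrite x1 andbT; apply: le_trans xge.
by rewrite ler_pdivrMr // mul1r ler_nat leq_pred.
Qed.

Lemma card_grid_cubes_graph_le X (f : R -> R) d (m : nat) : X `<=` `[0, 1] ->
  0 < d -> (0 < m)%N -> m%:R^-1 <= d -> d^-1 <= m%:R ->
  (forall x y, X x -> X y -> `|x - y| <= m%:R^-1 -> `|f x - f y| < 2^-1) ->
  finite_set (grid_cubes d (graph_of X f)) /\
  (#|` fset_set (grid_cubes d (graph_of X f))| <= 16 * g_m X m)%N.
Proof.
move=> X01 d0 m0 md dm fX.
have /choice [s hs] : forall k : nat, exists s : seq (int * int),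
    (size s <= 16 * min_card m (X `&` `[(k%:R / m%:R)%R, (k.+1%:R / m%:R)%R]))%N /\
    forall n x, X x -> k%:R / m%:R <= x <= k%:R / m%:R + m%:R^-1 ->
      in_cube d n (x, f x) -> n \in s.
  move=> k; have [s s1 s2] := @column_cover X f d m (k%:R / m%:R) d0 m0 md dm fX.
  exists s; split=> //; apply: leq_trans s1 _.
  suff -> : k%:R / m%:R + m%:R^-1 = k.+1%:R / m%:R :> R by [].
  by rewrite -[X in _ + X]mul1r -mulrDl natr1.
pose t := flatten [seq s k.-1 | k <- index_iota 1 m.+1].
have tF : forall n, grid_cubes d (graph_of X f) n -> n \in t.
  move=> n [[x y] [[/= Xx ->] nx]].
  have /X01 : X x by []; rewrite /= in_itv /= => /(grid_column m _ m0)[k km xk].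
  apply/flatten_mapP; exists k; first by rewrite mem_index_iota ltnS.
  exact: (hs k.-1).2 xk nx.
have [fin le_t] := @card_grid_cubes_le d _ t tF; split=> //.
apply: leq_trans le_t _.
rewrite size_flatten /shape -map_comp sumnE big_map /g_m big_distrr /=.
rewrite big_nat [X in (_ <= X)%N]big_nat; apply: leq_sum => k /andP[k0 _].
by have := (hs k.-1).1; rewrite prednK.
Qed.

End Grid.

(** * Upper bound for the dimension of every graph *)

Section UpperBound.
Context {R : realType}.
Implicit Types (X : set R).

Lemma ln_nat_ge0 (n : nat) : 0 <= ln (n%:R : R).
Proof.
case: n => [|n]; first by rewrite ln0.
by apply: ln_ge0; rewrite ler1n.
Qed.

(** This covers empty [X] as well, because [ln 0 = 0] here. *)
Lemma limn_esup_g_m_ge0 X :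
  (0 <= limn_esup (fun m : nat => (ln (g_m X m)%:R / ln m%:R : R)%:E))%E.
Proof.
apply: limf_esup_ge0 => [|m]; first exact: filter_not_empty.
by rewrite lee_fin divr_ge0 // ln_nat_ge0.
Qed.

Lemma upper_box_dim_graph_le X (f : R -> R) : X `<=` `[0, 1] ->
  unif_cont_on X f ->
  (upper_box_dim (graph_of X f) <=
   limn_esup (fun m : nat => (ln (g_m X m)%:R / ln m%:R)%:E))%E.
Proof.
move=> X01 ucf.
have := limn_esup_g_m_ge0 X.
case es : (limn_esup _) => [s| |] //; last by move=> _; exact: leey.
rewrite lee_fin => s0.
apply/lee_addgt0Pr => e e0; rewrite -EFinD.
pose t := s + e / 2.
have t0 : 0 < t by rewrite /t; lra.
have [V [N0 _ N0V] gt] : exists2 V : set nat, \oo V &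
    forall m, V m -> ((ln (g_m X m)%:R / ln m%:R)%:E < t%:E)%E.
  by apply: limf_esup_lt; rewrite -[limf_esup _ _]/(limn_esup _) es lte_fin /t; lra.
have h2 : 0 < 2^-1 :> R by lra.
have [d1 d10 fd1] := ucf _ h2.
(* From [N <= 16 g_m], [g_m < m ^ t] and [m <= 2 / d] one gets [ln N <= C + t (- ln d)]; for small
   [d] the constant [C] is absorbed by [(e / 2) (- ln d)]. *)
pose C := ln (16 : R) + t * ln 2.
have Nr : 0 < N0.+1%:R^-1 :> R by rewrite invr_gt0 ltr0n.
apply: limf_esup_le; near=> d.
have d0 : 0 < d by near: d; exact: nbhs_right_gt.
have d2 : d < 2^-1 by near: d; exact: nbhs_right_lt.
have dd1 : d < d1 by near: d; exact: nbhs_right_lt.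
have dN : d < N0.+1%:R^-1 by near: d; exact: nbhs_right_lt.
have dC : d < expR (- (C / (e / 2))).
  by near: d; apply: nbhs_right_lt; exact: expR_gt0.
have id2 : 2 < d^-1 by rewrite -[2]invrK ltf_pV2 ?posrE ?invr_gt0.
have id0 : 0 <= d^-1 by lra.
pose m := (Num.trunc d^-1).+1.
have /andP[ml mu] := truncn_itv id0; rewrite -/m in mu.
have m0 : (0 < m)%N by [].
have mR : 0 < m%:R :> R by rewrite ltr0n.
have imd : m%:R^-1 <= d.
  by rewrite -[d]invrK lef_pV2 ?posrE ?invr_gt0 // ltW.
have [] := @card_grid_cubes_graph_le _ X f d m X01 d0 m0 imd (ltW mu).
  by move=> x y Xx Xy xy; apply: fd1 => //; lra.
move=> fin leN; rewrite /= /box_ratio asboolT // lee_fin.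
have lnd : C / (e / 2) < - ln d.
  by rewrite ltrNr -[X in _ < X]expRK ltr_ln ?posrE ?expR_gt0.
have lnd0 : ln d < 0 by apply: ln_lt0; rewrite d0 /=; lra.
rewrite ler_pdivrMr; last by lra.
have m2 : 2 < m%:R :> R by lra.
have mN : (N0 <= m)%N.
  rewrite -(ler_nat R); apply: ltW; apply: lt_trans mu.
  apply: (@lt_trans _ _ N0.+1%:R); first by rewrite ltr_nat.
  by rewrite -[X in X < _]invrK ltf_pV2 ?posrE ?invr_gt0 ?ltr0n.
have lnm0 : 0 < ln (m%:R : R) by apply: ln_gt0; lra.
have := gt m (N0V m mN); rewrite lte_fin ltr_pdivrMr // => lng.
have lnm : ln (m%:R : R) <= ln 2 - ln d.
  rewrite -lnV ?posrE // -lnM ?posrE ?invr_gt0 //.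
  rewrite ler_ln ?posrE ?mulr_gt0 ?invr_gt0 //.
  by rewrite /m -natr1; lra.
have tl : t * ln (m%:R : R) <= t * (ln 2 - ln d) by rewrite ler_pM2l.
have Ce : C < - ln d * (e / 2) by rewrite -ltr_pdivrMr //; lra.
have CE : C = ln (16 : R) + t * ln 2 by [].
have tE : t = s + e / 2 by [].
set N := #|` _| in leN *.
(* When no cube is met, [ln 0 = 0] and the bound is nonnegative. *)
case: (posnP N) => [->|N0'].
  by rewrite ln0 // mulr_ge0 //; lra.
have g0 : (0 < g_m X m)%N.
  by move: (leq_trans N0' leN); rewrite muln_gt0.
have : ln (N%:R : R) <= ln (16 : R) + ln ((g_m X m)%:R).
  rewrite -lnM ?posrE ?ltr0n // ler_ln ?posrE ?mulr_gt0 ?ltr0n //.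
  by rewrite -natrM ler_nat.
have -> : s + e = t + e / 2 by rewrite tE; lra.
by move: lng tl Ce; rewrite CE mulrDl mulrBr mulrN mulNr; lra.
Unshelve. all: by end_near.
Qed.

End UpperBound.

(** * Lipschitz perturbations that spread out the points of each column *)

Section Lower.
Context {R : realType}.

Definition lipschitz_with (K : R) (h : R -> R) :=
  forall x y, `|h x - h y| <= K * `|x - y|.

(** The sum of all quotients [a / |x - y|] dominates each of them; diagonal terms vanish because
    division by zero gives zero. *)
Lemma separation_const (a : R) (s : seq R) : 0 <= a ->
  exists2 L, 0 <= L & {in s &, forall x y, x != y -> a <= L * `|x - y|}.
Proof.
move=> a0; pose F (x y : R) := a / `|x - y|.
have F0 x y : 0 <= F x y by rewrite divr_ge0.
exists (\sum_(x <- s) \sum_(y <- s) F x y).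
  by apply: sumr_ge0 => x _; exact: sumr_ge0.
move=> x y xs ys xy.
have nxy : 0 < `|x - y| by rewrite normr_gt0 subr_eq0.
rewrite -ler_pdivrMr // (big_rem x) //= (big_rem y) //= -addrA lerDl.
by rewrite addr_ge0 // sumr_ge0 // => z _; exact: sumr_ge0.
Qed.

(* McShane extension, truncated at [a]. *)
Lemma lipschitz_extension (a : R) (s : seq R) (v : R -> R) : 0 <= a ->
  {in s, forall x, 0 <= v x <= a} ->
  exists phi L, [/\ 0 <= L, lipschitz_with L phi, forall x, 0 <= phi x <= a &
    {in s, forall x, phi x = v x}].
Proof.
move=> a0 va; have [L L0 Ls] := separation_const a s a0.
pose phi (t : seq R) z := \big[Num.min/a]_(x <- t) (v x + L * `|z - x|).
have phic x t z : phi (x :: t) z = Num.min (v x + L * `|z - x|) (phi t z).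
  by rewrite /phi big_cons.
have phi0 z : phi [::] z = a by rewrite /phi big_nil.
exists (phi s), L; split=> //.
- have half x y : phi s x - phi s y <= L * `|x - y|.
    elim: s {va Ls} => [|z t IH]; first by rewrite !phi0 subrr mulr_ge0.
    rewrite !phic.
    have : L * `|x - z| <= L * `|x - y| + L * `|y - z|.
      by rewrite -mulrDr ler_wpM2l // ler_distD.
    by rewrite !minEle; do 2 case: ifPn; rewrite -?ltNge; lra.
  move=> x y; rewrite ler_norml half andbT lerNl opprB distrC; exact: half.
- move=> z; have : {subset s <= s} by [].
  elim: {1 3 4}s => [|x t IH] ts; first by rewrite phi0 a0 lexx.
  have /IH h : {subset t <= s} by move=> y yt; apply: ts; rewrite inE yt orbT.
  have /va vx : x \in s by apply: ts; rewrite inE eqxx.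
  have Lz : 0 <= L * `|z - x| by rewrite mulr_ge0.
  by rewrite phic minEle; case: ifPn; lra.
- move=> x xs; apply/eqP; rewrite eq_le; apply/andP; split.
    elim: s xs {va Ls} => // y t IH; rewrite inE phic => /predU1P[<-|/IH h].
      by rewrite ge_min subrr normr0 mulr0 addr0 lexx.
    by rewrite ge_min h orbT.
  have : {subset s <= s} by [].
  elim: {1 3}s => [|y t IH] ts; first by rewrite phi0; case/andP: (va x xs).
  have /IH h : {subset t <= s} by move=> z zt; apply: ts; rewrite inE zt orbT.
  have ys : y \in s by apply: ts; rewrite inE eqxx.
  rewrite phic le_min h andbT.
  have [->|xy] := eqVneq x y; first by rewrite lerDl mulr_ge0.
  (* By separation [v x <= a <= L |x - y| <= v y + L |x - y|], so the term of another point never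
     falls below [v x]. *)
  by have := Ls x y xs ys xy; have := va x xs; have := va y ys; lra.
Qed.

(** Half-open columns are disjoint, so truncating [x * m] recovers the column of a point. *)
Definition half_open_column (X : set R) (m k : nat) : set R :=
  X `&` `[k%:R / m%:R, k.+1%:R / m%:R[.

(** A closed column lies in two consecutive half-open ones, the second catching its right endpoint.
    The index [k = m] is included for the point 1. *)
Lemma g_m_le_half_open (X : set R) (m : nat) :
  (g_m X m <= 2 * \sum_(0 <= k < m.+1) min_card m (half_open_column X m k))%N.
Proof.
set c := fun k => min_card m (half_open_column X m k).
apply: (@leq_trans (\sum_(1 <= k < m.+1) (c k.-1 + c k))).
  rewrite /g_m big_nat [X in (_ <= X)%N]big_nat.
  apply: leq_sum => -[|k] // /andP[_ km] /=.
  apply: leq_trans (min_cardU _ _ _); apply: min_card_sub => x [Xx] /=.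
  rewrite in_itv /= => /andP[kx]; rewrite le_eqVlt => /predU1P[xE|xk].
    right; split=> //=; rewrite xE in_itv /= lexx ltr_pM2r ?ltr_nat ?leqnn //.
    by rewrite invr_gt0 ltr0n; lia.
  by left; split=> //=; rewrite in_itv /= kx.
rewrite big_split /= big_add1 /= mul2n -addnn; apply: leq_add.
  by rewrite [X in (_ <= X)%N]big_nat_recr //= leq_addr.
by rewrite [X in (_ <= X)%N]big_ltn // leq_addl.
Qed.

Lemma trunc_half_open (X : set R) (m k : nat) (x : R) : (0 < m)%N ->
  half_open_column X m k x -> Num.trunc (x * m%:R) = k.
Proof.
move=> m0 [_ /=]; rewrite in_itv /= => /andP[kx xk].
have mR : 0 < m%:R :> R by rewrite ltr0n.
by apply: truncn_def; rewrite -ler_pdivrMr // kx -ltr_pdivlMr.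
Qed.

(** The vertical room [a] holds about [m / M] values at spacing [a M / m >= (4 + K) / m], so about
    one point in [M] is kept per column, and the graph meets a different cube at each kept point. In
    the final bound [M] pays for this selection and 2 for passing to half-open columns. *)
Lemma perturbation (X : set R) (K a : R) (h : R -> R) (M m : nat) : 0 <= K ->
  lipschitz_with K h -> 0 < a -> 4 + K <= a * M%:R -> (0 < m)%N ->
  exists phi L, [/\ 0 <= L, lipschitz_with L phi, forall x, 0 <= phi x <= a &
    forall g : R -> R,
      (forall x, X x -> `|g x - (h x + phi x)| <= m%:R^-1) ->
      finite_set (grid_cubes m%:R^-1 (graph_of X g)) ->
      (g_m X m <=
       2 * M * #|` fset_set (grid_cubes m%:R^-1 (graph_of X g))|)%N].
Proof.
move=> K0 hK a0 aM m0.
have mR : 0 < m%:R :> R by rewrite ltr0n.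
have M0 : (0 < M)%N by case: M aM => //; rewrite mulr0; lra.
pose H := half_open_column X m.
pose c k := min_card m (H k).
(* This is [c k / M] rounded up, so a nonempty column keeps at least one point. *)
pose n k := ((c k + M.-1) %/ M)%N.
have cn k : (c k <= M * n k)%N.
  by rewrite /n; have := divn_eq (c k + M.-1) M; have := ltn_pmod (c k + M.-1) M0; lia.
have nc k q : (q < n k)%N -> (q * M < c k)%N.
  by rewrite /n leq_divRL // mulSn; lia.
have nlec k : (n k <= c k)%N.
  by case: (n k) (nc k) => // j /(_ j (ltnSn j)); nia.
have /choice [S hS] : forall k, exists s : seq R,
    [/\ uniq s, size s = n k & forall x, x \in s -> H k x].
  by move=> k; apply: has_at_least_leq _ _ _ (nlec k) _; exact: has_at_least_min_card.
pose w := a * M%:R / m%:R.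
pose col (x : R) := Num.trunc (x * m%:R).
pose v (x : R) := (index x (S (col x)))%:R * w.
have colS k x : x \in S k -> col x = k.
  by have [_ _ SH] := hS k; move=> /SH; exact: trunc_half_open.
have [|phi [L [L0 phiL phi_a phiv]]] :=
  @lipschitz_extension a [seq x | k <- iota 0 m.+1, x <- S k] v (ltW a0).
  move=> x /allpairsPdep[k [y [_ yk ->]]].
  rewrite /v (colS _ _ yk) mulr_ge0 ?ler0n ?divr_ge0 ?mulr_ge0 // ?(ltW a0) //=.
  have := yk; rewrite -index_mem; have [_ -> _] := hS k => /nc iM.
  (* Kept indices satisfy [index * M <= m], so the prescribed values [index * w] stay at most
     [a]. *)
  have {}iM : (index y (S k) * M <= m)%N by apply: leq_trans (ltnW iM) (min_card_le _ _).
  rewrite /w mulrA ler_pdivrMr // mulrCA ler_pM2l //.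
  by rewrite -natrM ler_nat.
exists phi, L; split=> // g hg fin.
pose cube (x : R) : int * int := ((col x)%:Z, Num.floor (g x * m%:R)).
pose C := [seq cube x | k <- iota 0 m.+1, x <- S k].
have szC : size C = \sum_(0 <= k < m.+1) n k.
  rewrite size_allpairs_dep sumnE big_map /index_iota subn0.
  by apply: eq_bigr => k _; have [_ -> _] := hS k.
have sub : (size C <= #|` fset_set (grid_cubes m%:R^-1 (graph_of X g))|)%N.
  apply: card_grid_cubes_ge => //; last first.
    move=> _ /allpairsPdep[k [x [_ xk ->]]].
    have [_ _ /(_ x xk) [Xx /=]] := hS k; rewrite in_itv /= => /andP[kx xk1].
    exists (x, g x); split; first by split.
    rewrite /cube (colS _ _ xk) /=; split.
      by rewrite intrD -!pmulrn natr1 kx ltW.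
    have /andP[fl fu] := floor_itv (g x * m%:R).
    by rewrite ler_pdivrMr // fl ler_pdivlMr // ltW.
  apply: allpairs_uniq_dep; first exact: iota_uniq.
    by move=> k _; have [] := hS k.
  move=> _ _ /allpairsPdep[k [x [km xk ->]]] /allpairsPdep[k' [y [_ yk ->]]] /=.
  rewrite /cube (colS _ _ xk) (colS _ _ yk) => -[kk' gxy].
  rewrite -kk' in yk *; congr existT; clear k' kk'.
  (* The first coordinate of the cube fixes the column; it remains to exclude two kept points of one
     column in the same row. *)
  apply/eqP/negPn/negP => xy.
  wlog ixy : x y xk yk gxy xy / (index x (S k) < index y (S k))%N => [wl|].
    have [i_lt|i_lt|i_eq] := ltngtP (index x (S k)) (index y (S k)).
    - exact: (wl x y).
    - by apply: (wl y x) => //; rewrite eq_sym.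
    - by move: xy; rewrite -(nth_index x xk) i_eq nth_index // eqxx.
  have inS z : z \in S k -> z \in [seq x | k <- iota 0 m.+1, x <- S k].
    move=> zk; apply/allpairsPdep; exists k, z; split=> //.
  have err z : z \in S k -> `|g z * m%:R - (h z * m%:R + phi z * m%:R)| <= 1.
    move=> zk; have [_ _ /(_ z zk) [Xz _]] := hS k.
    rewrite -mulrDl -mulrBl normrM (gtr0_norm mR) -ler_pdivlMr // mul1r.
    exact: hg.
  have phiE z : z \in S k -> phi z * m%:R = (index z (S k))%:R * (a * M%:R).
    by move=> zk; rewrite phiv ?inS // /v (colS _ _ zk) /w -mulrA divfK // gt_eqF.
  have hxy : `|h x * m%:R - h y * m%:R| <= K.
    have [_ _ SH] := hS k.
    have [_ /=] := SH x xk; rewrite in_itv /= => /andP[x1 x2].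
    have [_ /=] := SH y yk; rewrite in_itv /= => /andP[y1 y2].
    rewrite -mulrBl normrM (gtr0_norm mR).
    apply: le_trans (ler_wpM2r (ltW mR) (hK x y)) _.
    rewrite -mulrA -[X in _ <= X]mulr1 ler_wpM2l // -ler_pdivlMr // mul1r.
    have k1 : k.+1%:R / m%:R = k%:R / m%:R + m%:R^-1 :> R.
      by rewrite -natr1 mulrDl mul1r.
    by rewrite k1 in x2 y2; rewrite ler_norml; lra.
  have phixy : 4 + K <= phi y * m%:R - phi x * m%:R.
    rewrite !phiE // -mulrBl; apply: le_trans aM _.
    by rewrite ler_peMl ?mulr_ge0 ?(ltW a0) // lerBrDr nat1r ler_nat.
  have /andP[fx _] := floor_itv (g x * m%:R).
  have /andP[_ fy] := floor_itv (g y * m%:R).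
  rewrite -gxy intrD mulr1z in fy.
  (* After scaling by [m], [phi] separates the points by at least [4 + K], [h] takes back at most
     [K] and the two errors at most 2; the values of [g] differ by at least 2, but equal floors
     allow less than 1. *)
  move: (err x xk) (err y yk) hxy; rewrite !ler_norml.
  by lra.
apply: leq_trans (g_m_le_half_open X m) _.
rewrite -mulnA leq_mul2l /=; apply: leq_trans (leq_mul (leqnn M) sub).
by rewrite szC big_distrr /=; apply: leq_sum => k _; exact: cn.
Qed.

End Lower.

(** * Nested balls and a function whose graph has large dimension *)

Section LowerBound.
Context {R : realType} (X : set R) (r r1 : R).
Hypotheses (r0 : 0 <= r) (rr1 : r < r1).
Hypothesis g_m_large :
  forall N : nat, exists2 m, (N <= m)%N & r1 * ln m%:R < ln ((g_m X m)%:R : R).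

(** One step of the construction: [|h' - h| <= a - a'] puts the new ball inside the old one, and
    [i < m] will drive the scales [1/m] to zero. *)
Lemma perturbation_box_ratio (K a : R) (h : R -> R) (i : nat) : 0 <= K ->
  lipschitz_with K h -> 0 < a ->
  exists h' K' a' m, [/\ 0 <= K', lipschitz_with K' h', 0 < a' <= a / 2,
    forall x, `|h' x - h x| <= a - a' & (i < m)%N /\
    forall g : R -> R, (forall x, X x -> `|g x - h' x| <= a') ->
      (r%:E <= box_ratio (graph_of X g) m%:R^-1)%E].
Proof.
move=> K0 hK a0.
pose M := (Num.trunc ((4 + K) / (a / 2))).+1.
have a20 : 0 < a / 2 by lra.
have M0 : 0 <= (4 + K) / (a / 2) by rewrite divr_ge0 //; lra.
have aM : 4 + K <= a / 2 * M%:R.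
  by rewrite mulrC -ler_pdivrMr //; have /andP[_ /ltW] := truncn_itv M0.
(* For [m >= expR B] one has [2 M <= m ^ (r1 - r)], so the factor [2 M] costs only the gap between
   [r1] and [r]. The bound [i.+2] in [N] also makes [ln m] positive. *)
pose B := ln ((2 * M)%:R : R) / (r1 - r).
pose N := maxn i.+2 (Num.trunc (expR B)).+1.
have [m Nm gm] := g_m_large N.
have im : (i.+1 < m)%N by apply: leq_trans Nm; rewrite leq_maxl.
have m0 : (0 < m)%N by exact: leq_trans im.
have mR : 0 < m%:R :> R by rewrite ltr0n.
have lnm0 : 0 < ln (m%:R : R) by apply: ln_gt0; rewrite ltr1n; lia.
have lnB : ln ((2 * M)%:R : R) <= (r1 - r) * ln m%:R.
  rewrite mulrC -ler_pdivrMr ?subr_gt0 // -[X in X <= _]expRK.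
  rewrite ler_ln ?posrE ?expR_gt0 //.
  have /andP[_ /ltW] := truncn_itv (expR_ge0 B); move/le_trans; apply.
  by rewrite ler_nat; apply: leq_trans Nm; rewrite leq_maxr.
have [phi [L [L0 phiL phia phig]]] :=
  @perturbation _ X K (a / 2) h M m K0 hK a20 aM m0.
have im0 : 0 < m%:R^-1 :> R by rewrite invr_gt0.
(* Radius at most [1/m] lets [perturbation] apply to the whole ball; radius at most [a / 2] leaves
   room for [phi <= a / 2]. *)
exists (fun x => h x + phi x), (K + L), (Num.min (a / 2) m%:R^-1), m; split.
- exact: addr_ge0.
- move=> x y; rewrite mulrDl.
  have -> : h x + phi x - (h y + phi y) = (h x - h y) + (phi x - phi y) by lra.
  by apply: le_trans (ler_normD _ _) _; exact: lerD.
- by rewrite lt_min a20 im0 ge_min lexx.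
- move=> x; rewrite addrC addKr ger0_norm; last by case/andP: (phia x).
  have : Num.min (a / 2) m%:R^-1 <= a / 2 by rewrite ge_min lexx.
  by have := phia x; lra.
- split; first exact: ltnW.
  move=> g gh; rewrite /box_ratio; case: asboolP => [fin|_]; last by rewrite leey.
  have {}/phig : forall x, X x -> `|g x - (h x + phi x)| <= m%:R^-1.
    by move=> x /gh /le_trans; apply; rewrite ge_min lexx orbT.
  move=> /(_ fin); set c := #|` _| => gc.
  rewrite lee_fin lnV ?posrE // opprK ler_pdivlMr //.
  have g0 : (0 < g_m X m)%N.
    case: (posnP (g_m X m)) gm => // ->; rewrite [X in _ < X]ln0 // => h1.
    suff : 0 <= r1 * ln (m%:R : R) by lra.
    by apply: mulr_ge0; [exact: le_trans r0 (ltW rr1) | exact: ltW].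
  have := leq_trans g0 gc; rewrite muln_gt0 => /andP[_ c0].
  have : ln ((g_m X m)%:R : R) <= ln ((2 * M)%:R : R) + ln c%:R.
    rewrite -lnM ?posrE ?ltr0n // -natrM ler_ln ?posrE ?ltr0n ?muln_gt0 //.
    by rewrite ler_nat.
  by move: lnB gm; rewrite mulrBl; lra.
Qed.

Lemma exists_graph_box_dim_ge :
  exists2 f, unif_cont_on X f & (r%:E <= upper_box_dim (graph_of X f))%E.
Proof.
(* A state [(h, K, a)] is the ball of radius [a] about the [K]-Lipschitz centre [h]; a transition
   also records the scale [m]. *)
pose state := ((R -> R) * R * R)%type.
pose valid (s : state) := [/\ 0 <= s.1.2, lipschitz_with s.1.2 s.1.1 & 0 < s.2].
pose step (p : nat * state) (q : state * nat) :=
  [/\ valid q.1, q.1.2 <= p.2.2 / 2,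
    forall x, `|q.1.1.1 x - p.2.1.1 x| <= p.2.2 - q.1.2 & (p.1 < q.2)%N /\
    forall g : R -> R, (forall x, X x -> `|g x - q.1.1.1 x| <= q.1.2) ->
      (r%:E <= box_ratio (graph_of X g) q.2%:R^-1)%E].
have /choice [F hF] : forall p, exists q, valid p.2 -> step p q.
  move=> [i [[h K] a]].
  have [[K0 hK a0]|nv] := pselect (valid (h, K, a)); last by exists (h, K, a, 0%N).
  have [h' [K' [a' [m [? ? /andP[? ?] ? [? ?]]]]]] :=
    perturbation_box_ratio K a h i K0 hK a0.
  by exists (h', K', a', m).
pose st := fix st i : state :=
  if i is j.+1 then (F (j, st j)).1 else (fun=> 0, 0, 1).
have stv i : valid (st i).
  elim: i => [|i IH]; last by case: (hF (i, st i) IH).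
  by split=> //= x y; rewrite subrr normr0 mul0r.
have sts i : step (i, st i) (F (i, st i)) by apply: hF; exact: stv.
pose h i := (st i).1.1; pose a i := (st i).2.
have a0 i : 0 < a i by case: (stv i).
have a_half i : a i.+1 <= a i / 2 by case: (sts i).
have h_step i x : `|h i.+1 x - h i x| <= a i - a i.+1.
  by have [_ _ hs _] := sts i; exact: hs.
have h_near i j x : `|h (i + j)%N x - h i x| <= a i - a (i + j)%N.
  elim: j => [|j IH]; first by rewrite addn0 !subrr normr0.
  rewrite addnS; have := h_step (i + j)%N x.
  by move: IH; rewrite !ler_norml; lra.
(* Every lower envelope lies below every upper one, which makes the supremum below finite and keeps
   it in all the balls. *)
have nested i j x : h i x - a i <= h j x + a j.
  have [ij|/ltnW ji] := leqP i j.
    have := h_near i (j - i)%N x; rewrite subnKC // ler_norml.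
    by have := a0 j; lra.
  have := h_near j (i - j)%N x; rewrite subnKC // ler_norml.
  by have := a0 i; lra.
(* the common point of the balls of centres [h i] and radii [a i] *)
pose f x := sup (range (fun i => h i x - a i)).
have fh i x : `|f x - h i x| <= a i.
  have ub j : ubound (range (fun i => h i x - a i)) (h j x + a j).
    by move=> _ [k _ <-].
  have ne : range (fun i => h i x - a i) !=set0 by exists (h 0%N x - a 0%N), 0%N.
  have : f x <= h i x + a i by apply: ge_sup.
  have : h i x - a i <= f x.
    by apply: ub_le_sup; [exists (h 0%N x + a 0%N) | exists i].
  by rewrite ler_norml; lra.
have a_le i : a i <= i.+1%:R^-1.
  elim: i => [|i IH]; first by rewrite invr1.
  apply: le_trans (a_half i) _; rewrite ler_pdivrMr //.
  apply: le_trans IH _.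
  rewrite mulrC ler_pdivlMr ?ltr0n // mulrC ler_pdivrMr ?ltr0n //.
  by rewrite -natrM ler_nat ltn_Pmull.
exists f.
  move=> e e0; pose i := Num.trunc (3 / e).
  have [K0 hK _] := stv i; rewrite -/(h i) in hK.
  have ai : a i < e / 3.
    apply: le_lt_trans (a_le i) _; rewrite -[e / 3]invf_div ltf_pV2 ?posrE //.
      have : 0 <= 3 / e by rewrite divr_ge0 // ltW.
      by case/truncn_itv/andP.
    by rewrite divr_gt0.
  set K := (st i).1.2 in K0 hK.
  (* Three-term estimate: [f] is within [e / 3] of the Lipschitz centre [h i] at both points. Using
     [K + 1] avoids dividing by zero. *)
  exists (e / 3 / (K + 1)); first by rewrite !divr_gt0 //; lra.
  move=> x y _ _; rewrite ltr_pdivlMr; last by lra.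
  have := normr_ge0 (x - y).
  move: (fh i x) (fh i y) (hK x y); rewrite mulrDr mulr1 ler_distl ler_norml.
  move: (`|x - y|) => z; rewrite ler_norml ltr_norml; nra.
apply: limf_esup_ge => V [/= e e0 eV].
(* The scale [m] attached to step [i] exceeds [i], hence [1/m < e]; the ratio bound applies since
   [f] lies in ball [i + 1]. *)
pose i := Num.trunc e^-1.
have [_ _ _ [im hm]] := sts i; set m := (F _).2 in im hm.
exists (m%:R^-1); last by apply: hm => x _; exact: (fh i.+1).
have m0 : 0 < m%:R :> R by rewrite ltr0n; lia.
have im0 : 0 < m%:R^-1 :> R by rewrite invr_gt0.
apply: eV => //=; rewrite sub0r normrN gtr0_norm //.
rewrite -[e]invrK ltf_pV2 ?posrE ?invr_gt0 //.
have /truncn_itv/andP[_ it] : 0 <= e^-1 by rewrite invr_ge0 ltW.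
by apply: lt_le_trans it _; rewrite ler_nat.
Qed.

End LowerBound.

(** * The two bounds combined *)

Theorem theorem1 (R : realType) (X : set R) (hX : X `<=` `[0, 1]) :
  upper_graph_box_dim X =
  limn_esup (fun m : nat => (ln (g_m X m)%:R / ln m%:R)%:E).
Proof.
set s := limn_esup _.
have s0 : (0 <= s)%E by exact: limn_esup_g_m_ge0.
apply/eqP; rewrite eq_le; apply/andP; split.
  by apply: ge_ereal_sup => _ [f ucf <-]; exact: upper_box_dim_graph_le.
have between (r : R) : (r%:E < s)%E -> exists2 r1, r < r1 & (r1%:E < s)%E.
  case: (s) => [t| |] // rt; last by exists (r + 1); [lra | rewrite ltry].
  rewrite lte_fin in rt; exists ((r + t) / 2); first by lra.
  by rewrite lte_fin; lra.
have lower (r : R) : (r%:E < s)%E -> 0 <= r -> (r%:E <= upper_graph_box_dim X)%E.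
  move=> rs r0.
  have [r1 rr1 r1s] := between r rs.
  have freq (N : nat) :
      exists2 m, (N <= m)%N & r1 * ln m%:R < ln ((g_m X m)%:R : R).
    (* Requiring [m >= 2] makes [ln m] positive, so the quotient inequality can be multiplied
       out. *)
    have NV : \oo [set m | (maxn N 2 <= m)%N] by exists (maxn N 2).
    have [m /=] := limf_esup_gt _ _ _ _ r1s NV.
    rewrite geq_max => /andP[Nm m2]; rewrite lte_fin => h; exists m => //.
    by rewrite -ltr_pdivlMr // ln_gt0 // ltr1n.
  have [f ucf rf] := @exists_graph_box_dim_ge R X r r1 r0 rr1 freq.
  by apply: le_trans rf _; apply: ereal_sup_ubound; exists f.
(* The lower bound is available only for [r >= 0], so nonnegativity of the dimension is shown
   separately with the zero function: ratios at scales [d < 1] are nonnegative. *)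
have dim0 : (0 <= upper_graph_box_dim X)%E.
  apply: le_trans (ereal_sup_ubound _); last first.
    by exists (fun=> 0); [move=> e e0; exists 1 => // *; rewrite subrr normr0 | ].
  apply: limf_esup_ge => V V0.
  have [d [Vd d0 d1]] : exists d : R, [/\ V d, 0 < d & d < 1].
    have V' : 0^'+ (V `&` [set d : R | 0 < d < 1]).
      apply: filterI => //; near=> d; apply/andP; split; near: d.
        exact: nbhs_right_gt.
      exact: nbhs_right_lt.
    by have [d [Vd /andP[? ?]]] := filter_ex V'; exists d.
  exists d => //; rewrite /box_ratio; case: ifP => _; last by rewrite leey.
  by rewrite lee_fin divr_ge0 ?ln_nat_ge0 // oppr_ge0 ln_le0 // ltW.
(* If the dimension were a real [t < s], some [r] strictly between [t] and [s] would contradict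
   [lower]. *)
rewrite leNgt; apply/negP; case: (upper_graph_box_dim X) dim0 lower => [t| |] //=.
  rewrite lee_fin => t0 lower /between [r tr rs].
  by have := lower r rs (le_trans t0 (ltW tr)); rewrite lee_fin; lra.
by move=> _ _; rewrite ltNge leey.
Unshelve. all: by end_near.
Qed.
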